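(* Let $\{B^{H,K}_t,t\ge0\}$ be a bifractional Brownian motion with parameters $H\in(0,1)$, $K\in(0,1]$ such that $H\le1/2$ and $HK=1/6$. For integers $n>0$ and $j,k\ge0$ let $\beta_n(j,k)=\mathbb E\left[(B^{H,K}_{\frac{j+1}n}-B^{H,K}_{\frac jn})(B^{H,K}_{\frac{k+1}n}-B^{H,K}_{\frac kn})\right]$. Then for each real $t\ge0$, $$\lim_{n\to\infty}\sum_{j,k=0}^{\lfloor nt\rfloor-1}\beta_n(j,k)^3=\eta(t),\qquad \eta(t)=C_Kt,$$ where $$C_K=\frac1{8^K}\left(8+2\sum_{m=1}^\infty\left((m+1)^{\frac13}-2m^{\frac13}+(m-1)^{\frac13}\right)^3\right),$$ and $\eta$ is continuous and nondecreasing with $\eta(0)=0$.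
   Context: Bifractional Brownian motion $B^{H,K}$ with $H\in(0,1)$, $K\in(0,1]$ is the centered Gaussian process with covariance $\mathbb E[B^{H,K}_tB^{H,K}_s]=\frac1{2^K}(t^{2H}+s^{2H})^K-\frac1{2^K}|t-s|^{2HK}$. *)

(* Defs.v *)
From HB Require Import structures.
From mathcomp Require Export all_boot all_order all_algebra.
From mathcomp Require Export all_classical all_reals all_analysis.
Export Order.TTheory GRing.Theory Num.Theory.
Export numFieldNormedType.Exports.

Set Implicit Arguments.
Unset Strict Implicit.
Unset Printing Implicit Defensive.

Local Open Scope classical_set_scope.
Local Open Scope ring_scope.

(* [normal_prob m 0] is a junk value (the uniform law on [0, 1]), so the
   degenerate Gaussian law is given separately as a Dirac mass. *)
Definition gaussian_rv (d : measure_display) (T : measurableType d)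
    (R : realType) (P : probability T R) (X : T -> R) : Prop :=
  (exists m : R, forall A : set R, measurable A ->
     pushforward P X A = \d_m A) \/
  (exists m s : R, 0 < s /\ forall A : set R, measurable A ->
     pushforward P X A = normal_prob m s A).

(* Processes are indexed by R, but only their values at times t >= 0 matter. *)
Definition gaussian_process (d : measure_display) (T : measurableType d)
    (R : realType) (P : probability T R) (B : R -> {RV P >-> R}) : Prop :=
  forall (m : nat) (t a : 'I_m -> R), (forall i, 0 <= t i) ->
    gaussian_rv P (fun w => \sum_(i < m) a i * B (t i) w).

Definition bifBm_cov (R : realType) (H K t s : R) : R :=
  (2 `^ K)^-1 * (t `^ (2 * H) + s `^ (2 * H)) `^ K
  - (2 `^ K)^-1 * `|t - s| `^ (2 * H * K).

Record bifractional_brownian_motion (d : measure_display)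
    (T : measurableType d) (R : realType) (P : probability T R)
    (H K : R) (B : R -> {RV P >-> R}) : Prop := BifractionalBrownianMotion {
  bifBm_gaussian : gaussian_process B ;
  bifBm_centered : forall t : R, 0 <= t -> ('E_P[B t] = 0)%E ;
  bifBm_covE : forall t s : R, 0 <= t -> 0 <= s ->
    'E_P[B t \* B s]%E = (bifBm_cov H K t s)%:E
}.

Definition incr (d : measure_display) (T : measurableType d) (R : realType)
    (P : probability T R) (B : R -> {RV P >-> R}) (n j : nat) : T -> R :=
  B (j.+1%:R / n%:R) \- B (j%:R / n%:R).

Definition beta (d : measure_display) (T : measurableType d) (R : realType)
    (P : probability T R) (B : R -> {RV P >-> R}) (n j k : nat) : \bar R :=
  'E_P[incr B n j \* incr B n k]%E.

(* (m - 1) is a subtraction in R. *)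
Definition CK_term (R : realType) (m : nat) : R :=
  ((m%:R + 1) `^ 3^-1 - 2 * m%:R `^ 3^-1 + (m%:R - 1) `^ 3^-1) ^+ 3.

Definition CK (R : realType) (K : R) : R :=
  (8 `^ K)^-1 * (8 + 2 * limn (fun N : nat => \sum_(1 <= m < N) CK_term R m)).

Definition eta (R : realType) (K t : R) : R := CK K * t.

(* Main.v *)
Require Import Defs.
From mathcomp Require Import all_boot all_order all_algebra.
From mathcomp Require Import all_classical all_reals all_analysis.
From mathcomp Require Import ring lra.

(* By self-similarity beta_n(j,k) = n^(-1/3) 2^(-K) (a(j,k) + d(j,k)), where a is
   the mixed second difference of (x^(2H) + y^(2H))^K and d that of
   -|x - y|^(1/3). Concavity of x^K gives -1 <= a <= 0, and the sum of a over
   [0,N)^2 telescopes to a quantity of order N^(1/3); hence replacing (a + d)^3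
   by d^3 costs O(N^(1/3)) = o(N). As d depends only on |j - k|, passing from
   [0,N)^2 to [0,N+1)^2 adds 8 + 2 sum_(1 <= m <= N) d_m^3 to the sum of d^3,
   and Cesaro's lemma gives the limit of the means. Finally -1 <= d_m <= 0 and
   sum_m d_m >= -1 (telescoping), so sum_m d_m^3 >= -1 and C_K > 0. *)

Set Implicit Arguments.
Unset Strict Implicit.
Unset Printing Implicit Defensive.

Local Open Scope classical_set_scope.
Local Open Scope ring_scope.

(* Concavity of x^p is read off the convexity of its inverse x^(1/p). *)
Lemma concave_powR (R : realType) (p a b w : R) : 0 < p -> p <= 1 ->
  0 <= a -> 0 <= b -> 0 <= w -> w <= 1 ->
  w * a `^ p + (1 - w) * b `^ p <= (w * a + (1 - w) * b) `^ p.
Proof.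
move=> p0 p1 a0 b0 w0 w1.
have w'0 : 0 <= 1 - w by rewrite subr_ge0.
have pK x : 0 <= x -> (x `^ p) `^ p^-1 = x.
  by move=> x0; rewrite -powRrM divff ?gt_eqF// powRr1.
have := @convex_powR R p^-1 _ (Itv01 w0 w1) (a `^ p) (b `^ p).
rewrite invf_ge1// => /(_ p1).
rewrite !inE /= !in_itv /= !andbT !powR_ge0 => /(_ isT isT).
rewrite !convRE /= !pK// => h.
have lhs0 : 0 <= w * a `^ p + (1 - w) * b `^ p.
  by rewrite addr_ge0// mulr_ge0// powR_ge0.
have rhs0 : 0 <= w * a + (1 - w) * b by rewrite addr_ge0// mulr_ge0.
have := ge0_ler_powR (ltW p0) (powR_ge0 _ _) rhs0 h.
by rewrite -powRrM mulVf ?gt_eqF// powRr1.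
Qed.

(** Both [x + h] and [y] are convex combinations of [x] and [y + h], with the two weights exchanged;
    the two concavity inequalities add up to the claim. *)
Lemma powR_incr_noninc (R : realType) (p x y h : R) : 0 < p -> p <= 1 ->
  0 <= x -> x <= y -> 0 <= h ->
  (y + h) `^ p - y `^ p <= (x + h) `^ p - x `^ p.
Proof.
move=> p0 p1 x0 xy h0.
(* If the segment from [x] to [y + h] is a point, the weight [w] below would divide by 0. *)
have [e|s0] := eqVneq (y + h - x) 0.
  by have [-> ->] : y = x /\ h = 0 by split; lra.
have {}s0 : 0 < y + h - x by rewrite lt0r s0; lra.
pose w := h / (y + h - x).
have w0 : 0 <= w by rewrite divr_ge0// ltW.
have w1 : w <= 1 by rewrite ler_pdivrMr//; lra.
have yh0 : 0 <= y + h by lra.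
have ws : w * (y + h - x) = h by rewrite divfK// gt_eqF.
have := concave_powR p0 p1 x0 yh0 w0 w1.
have := concave_powR p0 p1 yh0 x0 w0 w1.
have -> : w * (y + h) + (1 - w) * x = x + h
  by transitivity (x + w * (y + h - x)); [ring | rewrite ws].
have -> : w * x + (1 - w) * (y + h) = y
  by transitivity (y + h - w * (y + h - x)); [ring | rewrite ws addrK].
lra.
Qed.

(** * Mixed second differences of the two parts of the covariance *)

Definition mixed_diff (R : realType) (f : nat -> nat -> R) (j k : nat) : R :=
  f j.+1 k.+1 - f j.+1 k - f j k.+1 + f j k.

Definition sum_powR (R : realType) (H K : R) (j k : nat) : R :=
  (j%:R `^ (2 * H) + k%:R `^ (2 * H)) `^ K.

(** The exponent is the value 1/3 of [2 * H * K]. *)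
Definition dist_powR (R : realType) (j k : nat) : R :=
  `|j%:R - k%:R| `^ 3^-1.

Lemma mixed_diff_sum (R : realType) (f : nat -> nat -> R) (N : nat) :
  \sum_(j < N) \sum_(k < N) mixed_diff f j k =
  f N N - f N 0%N - f 0%N N + f 0%N 0%N.
Proof.
under eq_bigr => j _.
  rewrite -(big_mkord xpredT) (eq_bigr (fun k => (f j.+1 k.+1 - f j k.+1)
    - (f j.+1 k - f j k))); last by move=> k _; rewrite /mixed_diff; ring.
  rewrite (@telescope_sumr _ 0 N (fun k => f j.+1 k - f j k))//.
  rewrite (_ : _ - _ = (f j.+1 N - f j.+1 0%N) - (f j N - f j 0%N)); last by ring.
  over.
rewrite -(big_mkord xpredT (fun j => (f j.+1 N - f j.+1 0%N) - (f j N - f j 0%N))).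
by rewrite (telescope_sumr (fun j => f j N - f j 0%N))//; ring.
Qed.

(** Concavity of x^K gives the upper bound. For the lower one, the increment from [u' + v] to
    [u' + v'] is nonnegative, and the one from [u + v] to [u + v'] is at most (k+1)^(2HK) - k^(2HK)
    <= 1, by concavity of x^K and then of x^(2HK). *)
Lemma mixed_diff_sum_powR (R : realType) (H K : R) (j k : nat) :
  0 < H -> 0 < K -> K <= 1 -> 2 * H * K <= 1 ->
  -1 <= mixed_diff (sum_powR H K) j k <= 0.
Proof.
move=> H0 K0 K1 HK; have p0 : 0 <= 2 * H by rewrite mulr_ge0// ltW.
rewrite /mixed_diff /sum_powR.
have mono (i : nat) : (i%:R : R) `^ (2 * H) <= i.+1%:R `^ (2 * H).
  by rewrite ge0_ler_powR ?nnegrE// ler_nat.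
set u := j%:R `^ _; set u' := j.+1%:R `^ _.
set v := k%:R `^ _; set v' := k.+1%:R `^ _.
have [u0 v0] : 0 <= u /\ 0 <= v by rewrite !powR_ge0.
have uu' : u <= u' by exact: mono.
have vv' : v <= v' by exact: mono.
have h0 : 0 <= v' - v by lra.
have := powR_incr_noninc K0 K1 (addr_ge0 u0 v0) (lerD uu' (lexx v)) h0.
have vu : v <= u + v by lra.
have := powR_incr_noninc K0 K1 v0 vu h0.
have -> : u' + v + (v' - v) = u' + v' by ring.
have -> : u + v + (v' - v) = u + v' by ring.
have -> : v + (v' - v) = v' by ring.
have : (u' + v) `^ K <= (u' + v') `^ K.
  by rewrite ge0_ler_powR ?nnegrE ?(ltW K0)//; lra.
have : v' `^ K - v `^ K <= 1.
  rewrite /v /v' -!powRrM.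
  have HK0 : 0 < 2 * H * K by rewrite !mulr_gt0.
  have := powR_incr_noninc HK0 HK (lexx 0) (ler0n R k) ler01.
  by rewrite add0r powR1 natr1 powR0 ?gt_eqF// subr0.
move: ((u' + v') `^ K) ((u' + v) `^ K) ((u + v') `^ K) ((u + v) `^ K).
move: (v' `^ K) (v `^ K); clear => *; lra.
Qed.

(** All terms have the same sign, so their absolute values telescope too, to 2 N^(1/3) - (2
    N^(2H))^K. *)
Lemma sum_mixed_diff_sum_powR (R : realType) (H K : R) (N : nat) :
  0 < H -> 0 < K -> K <= 1 -> H * K = 6^-1 ->
  \sum_(j < N) \sum_(k < N) `|mixed_diff (sum_powR H K) j k|
    <= 2 * N%:R `^ 3^-1.
Proof.
move=> H0 K0 K1 HK; have HK3 : 2 * H * K = 3^-1 by lra.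
under eq_bigr => j _.
  under eq_bigr => k _.
    rewrite ler0_norm; last first.
      by have /andP[] := @mixed_diff_sum_powR R H K j k H0 K0 K1 ltac:(lra).
    over.
  rewrite sumrN.
  over.
rewrite sumrN mixed_diff_sum /sum_powR.
have p0 : 2 * H != 0 by rewrite gt_eqF// mulr_gt0.
rewrite !powR0// !(addr0, add0r) powR0 ?gt_eqF// -!powRrM HK3.
by have := powR_ge0 (N%:R `^ (2 * H) + N%:R `^ (2 * H)) K; lra.
Qed.

(** * The series in [CK]: convergence and lower bound *)

Lemma CK_base_bounds (R : realType) (m : nat) : (0 < m)%N ->
  (-1 : R) <= (m%:R + 1 : R) `^ 3^-1 - 2 * m%:R `^ 3^-1 + (m%:R - 1) `^ 3^-1
    <= 0.
Proof.
case: m => // m _; rewrite -(natr1 m) addrK.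
have t0 : 0 < 3^-1 :> R by lra.
have t1 : 3^-1 <= 1 :> R by lra.
have mm : m%:R <= m%:R + 1 :> R by lra.
have := powR_incr_noninc t0 t1 (ler0n R m) mm ler01.
have := powR_incr_noninc t0 t1 (lexx 0) (ler0n R m) ler01.
rewrite add0r powR1 powR0 ?gt_eqF//.
have : (m%:R + 1) `^ 3^-1 <= (m%:R + 1 + 1) `^ 3^-1 :> R.
  by have h := ler0n R m; rewrite ge0_ler_powR ?nnegrE//; lra.
lra.
Qed.

Lemma CK_term_le0 (R : realType) (m : nat) : (0 < m)%N -> CK_term R m <= 0.
Proof.
move=> m0; have /andP[_] := CK_base_bounds R m0; rewrite /CK_term.
by move=> h; rewrite exprS mulr_le0_ge0// sqr_ge0.
Qed.

Lemma le_cube (R : realDomainType) (x : R) : -1 <= x -> x <= 0 -> x <= x ^+ 3.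
Proof.
move=> x1 x0; rewrite -subr_ge0.
have -> : x ^+ 3 - x = - x * ((1 - x) * (1 + x)) by ring.
by rewrite !mulr_ge0// ?oppr_ge0//; lra.
Qed.

Lemma CK_partial_ge (R : realType) (N : nat) :
  -1 <= \sum_(1 <= m < N) CK_term R m.
Proof.
apply: (@le_trans _ _ (\sum_(1 <= m < N)
  ((m%:R + 1) `^ 3^-1 - 2 * m%:R `^ 3^-1 + (m%:R - 1) `^ 3^-1))); last first.
  rewrite big_nat_cond [leRHS]big_nat_cond; apply: ler_sum => m /andP[/andP[m1 _] _].
  have /andP[] := CK_base_bounds R m1; rewrite /CK_term.
  exact: le_cube.
case: N => [|N]; first by rewrite big_geq// lerN10.
rewrite (eq_bigr (fun m => (m.+1%:R `^ 3^-1 - (m.+1%:R - 1) `^ 3^-1) -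
    (m%:R `^ 3^-1 - (m%:R - 1) `^ 3^-1))); last first.
  by move=> m _; rewrite -(natr1 m) addrK; ring.
(* What remains is (N+1)^(1/3) - N^(1/3) - 1, the last term coming from m = 1. *)
rewrite (telescope_sumr (fun m => m%:R `^ 3^-1 - (m%:R - 1) `^ 3^-1))//.
rewrite powR1 subrr powR0 ?gt_eqF// -(natr1 N) addrK.
have : (N%:R : R) `^ 3^-1 <= (N%:R + 1) `^ 3^-1.
  by rewrite ge0_ler_powR ?nnegrE// ?lerDl// addr_ge0.
lra.
Qed.

(** Convergence ensures that [limn] in [CK] is the sum of the series and not a default value. *)
Lemma CK_partial_cvg (R : realType) :
  cvgn (fun N : nat => \sum_(1 <= m < N) CK_term R m).
Proof.
apply: nonincreasing_is_cvgn; last first.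
  by exists (-1) => _ [N _ <-]; exact: CK_partial_ge.
(* From index 0 to index 1 no term is added: both ranges are empty. *)
apply/nonincreasing_seqP => -[|N]; first by rewrite !big_geq.
by rewrite big_nat_recr//= gerDl CK_term_le0.
Qed.

Lemma CK_gt0 (R : realType) (K : R) : 0 < CK K.
Proof.
rewrite /CK mulr_gt0 ?invr_gt0 ?powR_gt0//.
have : -1 <= limn (fun N : nat => \sum_(1 <= m < N) CK_term R m).
  by apply: limr_ge; [exact: CK_partial_cvg | apply: nearW => N; exact: CK_partial_ge].
lra.
Qed.

(** * Cubes of the stationary part, summed over a square *)

Lemma mixed_diff_dist_powRC (R : realType) (j k : nat) :
  mixed_diff (@dist_powR R) j k = mixed_diff (@dist_powR R) k j.
Proof.
rewrite /mixed_diff /dist_powR distrC (distrC j%:R k%:R).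
by rewrite (distrC j.+1%:R k%:R) (distrC j%:R k.+1%:R); ring.
Qed.

(** The cube of the opposite value is the constant 8 in [CK]. *)
Lemma mixed_diff_dist_powR_diag (R : realType) (k : nat) :
  mixed_diff (@dist_powR R) k k = - 2.
Proof.
rewrite /mixed_diff /dist_powR !subrr normr0 powR0 ?gt_eqF//.
have -> : k.+1%:R - k%:R = 1 :> R by rewrite -(natr1 k); ring.
have -> : k%:R - k.+1%:R = - 1 :> R by rewrite -(natr1 k); ring.
by rewrite normrN normr1 powR1; ring.
Qed.

Lemma mixed_diff_dist_powR_off (R : realType) (k m : nat) : (0 < m)%N ->
  mixed_diff (@dist_powR R) (k + m) k =
  - ((m%:R + 1) `^ 3^-1 - 2 * m%:R `^ 3^-1 + (m%:R - 1) `^ 3^-1).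
Proof.
move=> m0; have m1 : 1 <= m%:R :> R by rewrite ler1n.
have m0' : 0 <= m%:R :> R by lra.
rewrite /mixed_diff /dist_powR -(natr1 (k + m)) -(natr1 k) natrD.
rewrite (_ : k%:R + m%:R + 1 - (k%:R + 1) = m%:R); last by ring.
rewrite (_ : k%:R + m%:R + 1 - k%:R = m%:R + 1); last by ring.
rewrite (_ : k%:R + m%:R - (k%:R + 1) = m%:R - 1); last by ring.
rewrite (_ : k%:R + m%:R - k%:R = m%:R); last by ring.
by rewrite !ger0_norm ?subr_ge0 ?addr_ge0//; ring.
Qed.

Lemma double_sumS (R : realType) (g : nat -> nat -> R) (N : nat) :
  (forall j k, g j k = g k j) ->
  \sum_(j < N.+1) \sum_(k < N.+1) g j k =
  \sum_(j < N) \sum_(k < N) g j k + 2 * (\sum_(k < N) g N k) + g N N.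
Proof.
move=> gC; rewrite big_ord_recr/= big_ord_recr/=.
under eq_bigr do rewrite big_ord_recr/=.
rewrite big_split/=.
have -> : \sum_(k < N) g k N = \sum_(k < N) g N k.
  by apply: eq_bigr => k _; exact: gC.
ring.
Qed.

(** Enlarging the square adds a corner, equal to 8, and two borders with equal sums; the result is a
    sum of convergent terms, ready for Cesaro. *)
Lemma sum_cube_dist_powR (R : realType) (N : nat) :
  \sum_(j < N) \sum_(k < N) (- mixed_diff (@dist_powR R) j k) ^+ 3 =
  \sum_(0 <= i < N) (8 + 2 * \sum_(1 <= m < i.+1) CK_term R m).
Proof.
elim: N => [|N IH]; first by rewrite big_ord0 big_geq.
rewrite (@double_sumS R (fun j k => (- mixed_diff (@dist_powR R) j k) ^+ 3)); last first.
  by move=> j k; rewrite mixed_diff_dist_powRC.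
rewrite IH big_nat_recr//= mixed_diff_dist_powR_diag.
have -> : \sum_(k < N) (- mixed_diff (@dist_powR R) N k) ^+ 3 =
    \sum_(1 <= m < N.+1) CK_term R m.
  (* Reversing the order of summation matches [k] with m = N - k. *)
  rewrite big_add1/= big_mkord [RHS](reindex_inj rev_ord_inj)/=.
  apply: eq_bigr => k _; have kN := ltnW (ltn_ord k).
  rewrite subnSK// -{1}(subnKC kN) mixed_diff_dist_powR_off ?subn_gt0//.
  by rewrite opprK.
by ring.
Qed.

Lemma cube_diff_le (R : realDomainType) (a d : R) : `|a| <= 1 -> `|d| <= 2 ->
  `|(a + d) ^+ 3 - d ^+ 3| <= 19 * `|a|.
Proof.
move=> a1 d2.
(* The second factor is at most 1 + 3 * 2 + 3 * 4 = 19 in absolute value. *)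
have -> : (a + d) ^+ 3 - d ^+ 3 = a * (a ^+ 2 + 3 * a * d + 3 * d ^+ 2) by ring.
rewrite normrM mulrC ler_wpM2r//.
move: a1 d2; rewrite !ler_norml => /andP[? ?] /andP[? ?]; apply/andP; split; nra.
Qed.

Lemma norm_mixed_diff_dist_powR (R : realType) (j k : nat) :
  `|mixed_diff (@dist_powR R) j k| <= 2.
Proof.
wlog kj : j k / (k <= j)%N => [hw|].
  by case/orP: (leq_total k j) => ?; [|rewrite mixed_diff_dist_powRC]; exact: hw.
rewrite -(subnKC kj); have [->|m0] := posnP (j - k)%N.
  by rewrite addn0 mixed_diff_dist_powR_diag normrN ger0_norm.
rewrite mixed_diff_dist_powR_off// normrN ler_norml.
have /andP[] := CK_base_bounds R m0.
by move=> h1 h2; rewrite (le_trans _ h1) ?(le_trans h2)//; lra.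
Qed.

(** * From expectations to mixed differences *)

Lemma sqr_expectation_Lfun2 (d : measure_display) (T : measurableType d)
    (R : realType) (P : probability T R) (X : {RV P >-> R}) (r : R) :
  'E_P[X \* X]%E = r%:E -> (X : T -> R) \in Lfun P 2%:E.
Proof.
rewrite unlock => Er; rewrite inE; apply/andP; split; rewrite inE/=.
  exact: measurable_funPT.
rewrite /finite_norm unlock poweR_lty//.
rewrite [ltLHS](_ : _ = r%:E) ?ltry// -Er; apply: eq_integral => x _ /=.
by rewrite powR_mulrn// real_normK ?num_real// expr2.
Qed.

(** Products of two square-integrable functions are integrable, so linearity of the expectation
    applies. *)
Lemma expectation_mul_sub (d : measure_display) (T : measurableType d)
    (R : realType) (P : probability T R) (X Y Z W : T -> R) :
  X \in Lfun P 2%:E -> Y \in Lfun P 2%:E ->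
  Z \in Lfun P 2%:E -> W \in Lfun P 2%:E ->
  'E_P[(X \- Y)%R \* (Z \- W)%R]%E =
  ('E_P[X \* Z] - 'E_P[X \* W] - ('E_P[Y \* Z] - 'E_P[Y \* W]))%E.
Proof.
move=> X2 Y2 Z2 W2.
have -> : ((X \- Y) \* (Z \- W) =
      (X \* Z \- X \* W) \- (Y \* Z \- Y \* W))%R.
  by apply/funext => w /=; ring.
by rewrite !expectationB ?rpredB ?Lfun2_mul_Lfun1.
Qed.

(** Self-similarity, used with r = 1/n to pass from the grid of mesh 1/n to integer times. *)
Lemma bifBm_cov_scale (R : realType) (H K r t s : R) :
  0 <= r -> 0 <= t -> 0 <= s ->
  bifBm_cov H K (r * t) (r * s) = r `^ (2 * H * K) * bifBm_cov H K t s.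
Proof.
move=> r0 t0 s0; rewrite /bifBm_cov.
have -> : `|r * t - r * s| = r * `|t - s|.
  by rewrite -(mulrBr r t s) normrM (ger0_norm r0).
rewrite (powRM _ r0 t0) (powRM _ r0 s0) (powRM _ r0 (normr_ge0 _)) -mulrDr.
by rewrite (powRM _ (powR_ge0 _ _)) ?addr_ge0 ?powR_ge0// -powRrM; ring.
Qed.

Lemma beta_mixed_diff (d : measure_display) (T : measurableType d)
    (R : realType) (P : probability T R) (H K : R) (B : R -> {RV P >-> R})
    (n j k : nat) :
  2 * H * K = 3^-1 -> bifractional_brownian_motion H K B ->
  beta B n j k = (n%:R^-1 `^ 3^-1 * (2 `^ K)^-1 *
    (mixed_diff (sum_powR H K) j k - mixed_diff (@dist_powR R) j k))%:E.
Proof.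
move=> HK [_ _ covE]; have t0 i : 0 <= i%:R / n%:R :> R by rewrite divr_ge0.
(* The covariance formula at equal times makes the second moment finite. *)
have L2 i : (B (i%:R / n%:R) : T -> R) \in Lfun P 2%:E.
  exact: sqr_expectation_Lfun2 (covE _ _ (t0 i) (t0 i)).
rewrite /beta /incr expectation_mul_sub// !covE// -!EFinB; congr EFin.
have scale i l : bifBm_cov H K (i%:R / n%:R) (l%:R / n%:R) =
    n%:R^-1 `^ 3^-1 * (2 `^ K)^-1 * (sum_powR H K i l - dist_powR R i l).
  rewrite ![_ / n%:R]mulrC bifBm_cov_scale ?invr_ge0// HK.
  by rewrite /bifBm_cov HK /sum_powR /dist_powR; ring.
rewrite 4!scale /mixed_diff.
by move: (sum_powR H K) (@dist_powR R) => f g; ring.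
Qed.

Lemma beta_cube_sum (d : measure_display) (T : measurableType d)
    (R : realType) (P : probability T R) (H K : R) (B : R -> {RV P >-> R})
    (n N : nat) :
  2 * H * K = 3^-1 -> bifractional_brownian_motion H K B ->
  (\sum_(j < N) \sum_(k < N) beta B n j k ^+ 3)%E =
  ((8 `^ K)^-1 * n%:R^-1 * \sum_(j < N) \sum_(k < N)
    (mixed_diff (sum_powR H K) j k - mixed_diff (@dist_powR R) j k) ^+ 3)%:E.
Proof.
move=> HK bB; rewrite mulr_sumr -sumEFin; apply: eq_bigr => j _.
rewrite mulr_sumr -sumEFin; apply: eq_bigr => k _.
rewrite (beta_mixed_diff _ _ _ HK bB) -EFin_expe; congr EFin.
(* The cube of n^(-1/3) 2^(-K) is n^(-1) 8^(-K). *)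
rewrite !exprMn; congr (_ * _); rewrite mulrC; congr (_ * _).
  rewrite exprVn -powR_mulrn ?powR_ge0// powRAC powR_mulrn//.
  by congr (_ `^ _)^-1; ring.
by rewrite -powR_mulrn ?powR_ge0// -powRrM mulVf// powRr1 ?invr_ge0.
Qed.

(** * Passage to the limit *)

Lemma cvg_powR_div (R : realType) (p : R) : p < 1 ->
  n%:R^-1 * n%:R `^ p @[n --> \oo] --> (0 : R).
Proof.
move=> p1; have q0 : 0 < 1 - p by rewrite subr_gt0.
have : (harmonic n) `^ (1 - p) @[n --> \oo] --> (0 : R).
  have h0 : @harmonic R n @[n --> \oo] --> 0^'+.
    move=> A hA.
    have hA' : \forall n \near \oo, 0 < @harmonic R n -> A (harmonic n).
      exact: (@cvg_harmonic R _ hA).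
    by apply: filterS hA' => n; apply; rewrite /harmonic/= invr_gt0.
  exact: cvg_comp h0 (powR_cvg0 q0).
(* After the shift the base n + 1 is nonzero, and (n+1)^(-1) (n+1)^p = (1/(n+1))^(1-p). *)
rewrite -[X in _ -> X]cvg_shiftS; apply: cvg_trans; apply: near_eq_cvg.
apply: nearW => n /=; rewrite -powR_inv1// -powRrM -powRD ?pnatr_eq0 ?implybT//.
by congr (_ `^ _); ring.
Qed.

Lemma cube_sum_dist_le (R : realType) (H K : R) (N : nat) :
  0 < H -> 0 < K -> K <= 1 -> H * K = 6^-1 ->
  `|\sum_(j < N) \sum_(k < N)
      (mixed_diff (sum_powR H K) j k - mixed_diff (@dist_powR R) j k) ^+ 3
    - \sum_(j < N) \sum_(k < N) (- mixed_diff (@dist_powR R) j k) ^+ 3|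
  <= 38 * N%:R `^ 3^-1.
Proof.
move=> H0 K0 K1 HK; rewrite -sumrB.
have := sum_mixed_diff_sum_powR N H0 K0 K1 HK.
(* The constant is 38 = 19 * 2, from [cube_diff_le] and the bound on the sum of absolute values. *)
rewrite -(ler_pM2l (_ : 0 < 19 :> R))// mulrA -natrM => /(le_trans _); apply.
rewrite mulr_sumr (le_trans (ler_norm_sum _ _ _))//; apply: ler_sum => j _.
rewrite -sumrB mulr_sumr (le_trans (ler_norm_sum _ _ _))//.
apply: ler_sum => k _; apply: cube_diff_le.
  have HK1 : 2 * H * K <= 1 by lra.
  have /andP[? ?] := mixed_diff_sum_powR j k H0 K0 K1 HK1.
  by rewrite ler_norml; apply/andP; split=> //; exact: (le_trans _ ler01).
by rewrite normrN norm_mixed_diff_dist_powR.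
Qed.

Lemma cvg_cube_mean (R : realType) (H K : R) :
  0 < H -> 0 < K -> K <= 1 -> H * K = 6^-1 ->
  N%:R^-1 * \sum_(j < N) \sum_(k < N)
    (mixed_diff (sum_powR H K) j k - mixed_diff (@dist_powR R) j k) ^+ 3
  @[N --> \oo] -->
  8 + 2 * limn (fun N : nat => \sum_(1 <= m < N) CK_term R m).
Proof.
move=> H0 K0 K1 HK.
pose S N : R := \sum_(j < N) \sum_(k < N)
  (mixed_diff (sum_powR H K) j k - mixed_diff (@dist_powR R) j k) ^+ 3.
pose D N : R := \sum_(j < N) \sum_(k < N) (- mixed_diff (@dist_powR R) j k) ^+ 3.
set L := limn _; change (N%:R^-1 * S N @[N --> \oo] --> 8 + 2 * L).
have D_cvg : N%:R^-1 * D N @[N --> \oo] --> 8 + 2 * L.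
  have u_cvg : 8 + 2 * \sum_(1 <= m < i.+1) CK_term R m @[i --> \oo]
      --> 8 + 2 * L.
    apply: cvgD; [exact: cvg_cst | apply: cvgMr].
    have : \sum_(1 <= m < N) CK_term R m @[N --> \oo] --> L.
      exact: CK_partial_cvg.
    by rewrite -cvg_shiftS.
  (* The shift is needed because [arithmetic_mean] at index n averages n + 1 terms. *)
  rewrite -cvg_shiftS; have := cesaro u_cvg; rewrite /arithmetic_mean /series /=.
  by under eq_fun do rewrite -sum_cube_dist_powR.
have SD_cvg : N%:R^-1 * (S N - D N) @[N --> \oo] --> 0.
  apply: norm_cvg0; apply: (@squeeze_cvgr _ _ _ _ (cst 0)
    (fun N => 38 * (N%:R^-1 * N%:R `^ 3^-1))).
  - apply: nearW => N /=; rewrite normr_ge0/= normrM ger0_norm ?invr_ge0//.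
    by rewrite mulrCA ler_wpM2l ?invr_ge0//; exact: cube_sum_dist_le.
  - exact: cvg_cst.
  - by rewrite -[X in _ --> X](mulr0 38); apply: cvgMr; apply: cvg_powR_div; lra.
rewrite -[8 + 2 * L]addr0.
have -> : (fun N => N%:R^-1 * S N) =
    (fun N => N%:R^-1 * D N + N%:R^-1 * (S N - D N)).
  by apply/funext => N; ring.
exact: cvgD D_cvg SD_cvg.
Qed.

(** For t >= 0 truncation is the floor, so the quotient lies between t - 1/n and t. *)
Lemma cvg_truncn_div (R : realType) (t : R) : 0 <= t ->
  n%:R^-1 * (Num.truncn (n%:R * t))%:R @[n --> \oo] --> t.
Proof.
move=> t0; rewrite -cvg_shiftS /=.
apply: (@squeeze_cvgr _ _ _ _ (fun n => t - harmonic n) (cst t)).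
- apply: nearW => n; rewrite /harmonic/= mulrC ler_pdivlMr// ler_pdivrMr//.
  have nt0 : 0 <= n.+1%:R * t by rewrite mulr_ge0.
  have /andP[le lt] := truncn_itv nt0.
  rewrite (mulrC t) le andbT mulrBl mulVf ?pnatr_eq0// lerBlDr natr1 (mulrC t).
  exact: ltW.
- by rewrite -[X in _ --> X]subr0; apply: cvgB; [exact: cvg_cst | exact: cvg_harmonic].
- exact: cvg_cst.
Qed.

Lemma cvg_truncn_mul (R : realType) (t : R) : 0 < t ->
  Num.truncn (n%:R * t) @[n --> \oo] --> \oo.
Proof.
move=> t0; apply/cvgnyPge => A; near=> n.
rewrite truncn_ge_nat ?mulr_ge0// ?(ltW t0)// -ler_pdivrMr//.
by near: n; exact: nbhs_infty_ger.
Unshelve. all: by end_near. Qed.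

(** With N the truncation of n t, n^(-1) S_N = (N/n) (N^(-1) S_N); the first factor tends to t, the
    second to the limit of the cube means along N. *)
Lemma cvg_cube_sum (R : realType) (H K t : R) :
  0 < H -> 0 < K -> K <= 1 -> H * K = 6^-1 -> 0 <= t ->
  (8 `^ K)^-1 * n%:R^-1 * \sum_(j < Num.truncn (n%:R * t))
    \sum_(k < Num.truncn (n%:R * t))
      (mixed_diff (sum_powR H K) j k - mixed_diff (@dist_powR R) j k) ^+ 3
  @[n --> \oo] --> eta K t.
Proof.
(* At t = 0 the index N does not tend to infinity, but all sums are empty. *)
move=> H0 K0 K1 HK t0; have [->|tn0] := eqVneq t 0.
  rewrite /eta mulr0; apply: cvg_near_cst; apply: nearW => n.
  by rewrite mulr0 truncn0 big_ord0 mulr0.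
have {}t0 : 0 < t by rewrite lt0r tn0.
have mean := cvg_comp _ _ (cvg_truncn_mul t0) (cvg_cube_mean H0 K0 K1 HK).
rewrite /eta /CK -mulrA (mulrC _ t).
apply: cvg_trans (cvgM (cvg_cst _) (cvgM (cvg_truncn_div (ltW t0)) mean)).
apply: near_eq_cvg; near=> n => /=.
(* Cancelling N against its inverse needs N nonzero; for N = 0 both sides vanish. *)
set N := Num.truncn _; have [->|N0] := posnP N; first by rewrite !big_ord0 !mulr0.
have NN : N%:R != 0 :> R by rewrite pnatr_eq0 -lt0n.
by rewrite -!mulrA (mulrA N%:R) mulfV// mul1r.
Unshelve. all: by end_near. Qed.

Theorem proposition4p2 (d : measure_display) (T : measurableType d)
    (R : realType) (P : probability T R) (H K : R) (B : R -> {RV P >-> R})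
    (H_gt0 : 0 < H) (H_lt1 : H < 1) (K_gt0 : 0 < K) (K_le1 : K <= 1)
    (H_le_half : H <= 2^-1) (HK : H * K = 6^-1)
    (bifBm : bifractional_brownian_motion H K B) :
  [/\ cvgn (fun N : nat => \sum_(1 <= m < N) CK_term R m),
      forall t : R, 0 <= t ->
        (\sum_(j < Num.truncn (n%:R * t)%R) \sum_(k < Num.truncn (n%:R * t)%R)
            beta B n j k ^+ 3)%E @[n --> \oo] --> (eta K t)%:E,
      {within `[0, +oo[, continuous (eta K)},
      {in `[0, +oo[ &, {homo eta K : x y / x <= y}} &
      eta K 0 = 0].
Proof.
have HK3 : 2 * H * K = 3^-1 by lra.
split.
- exact: CK_partial_cvg.
- move=> t t0.
  under eq_fun do rewrite (beta_cube_sum _ _ HK3 bifBm).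
  apply: cvg_EFin; first exact: nearW.
  exact: cvg_cube_sum.
- by apply: continuous_subspaceT => x; exact: mulrl_continuous.
- by move=> x y _ _ xy; rewrite /eta ler_wpM2l// ltW// CK_gt0.
- by rewrite /eta mulr0.
Qed.
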